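(* Consider the adaptive circuit $\mathcal{E}=\mathcal{U}_T\circ\mathcal{A}_T\circ\cdots\circ\mathcal{U}_1\circ\mathcal{A}_1\circ\mathcal{U}_0$, a Gaussian initial state $|\phi_0\rangle$, a positive integer $k$, and the randomly drawn sparsified operator $\Omega$, all as described in the context. The variance of the normalization of $\Omega$ is bounded as $$\operatorname{Var}(\operatorname{Tr}\Omega)\le\frac{4(\widetilde C-1)}{k}+2\left(\frac{\|c\|_1^2}{k}\right)^2+\frac{10-12\widetilde C}{k^2}+O\left(\frac{\widetilde C}{k^3}\right),$$ where $$\widetilde C=\|c\|_1\sum_{\vec w}|c_{\vec w}|\cdot\left|\sum_{\vec m}\langle\psi_{\vec m}|\phi_{\vec m,\vec w}\rangle\right|^2 .$$ Here $O(\widetilde C/k^3)$ denotes a term bounded by an absolute constant times $\widetilde C/k^3$.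
   Context: Gaussian objects. On $n$ qubits let $c_{2j-1}=Z^{\otimes(j-1)}\otimes X\otimes I^{\otimes(n-j)}$ and $c_{2j}=Z^{\otimes(j-1)}\otimes Y\otimes I^{\otimes(n-j)}$, $j=1,\dots,n$. A unitary $U$ is Gaussian if there is $R\in O(2n)$ with $Uc_jU^\dagger=\sum_{k}R_{j,k}c_k$ for all $j$. A pure state is Gaussian if it equals $U|0\rangle^{\otimes n}$ with $U$ Gaussian. Circuit. $\mathcal{U}_t(\cdot)=U_t(\cdot)U_t^\dagger$ for $t=0,\dots,T$, where the $n$-qubit unitary $U_t$ has a known finite decomposition $U_t=\sum_v\alpha_{t,v}V_{t,v}$ with nonzero $\alpha_{t,v}\in\mathbb{C}$ and Gaussian unitaries $V_{t,v}$; $\|\alpha_t\|_1=\sum_v|\alpha_{t,v}|$. For $t=1,\dots,T$, $\mathcal{A}_t(\cdot)=\sum_{m\in\{0,1\}}K_{t,m}(\cdot)K_{t,m}^\dagger$ is a CPTP adaptive channel whose Kraus operators $K_{t,0},K_{t,1}$ are free operators, i.e. they map Gaussian states to (possibly subnormalized) Gaussian states. Indices: $\vec m=(m_1,\dots,m_T)\in\{0,1\}^T$, and patterns $\vec v=(v_0,\dots,v_T)$ of indices in the gate decompositions. Put $K_{\vec m}=U_TK_{T,m_T}\cdots U_1K_{1,m_1}U_0$, $|\psi_{\vec m}\rangle=K_{\vec m}|\phi_0\rangle$, $|\phi_{\vec m,\vec v}\rangle=V_{T,v_T}K_{T,m_T}\cdots V_{1,v_1}K_{1,m_1}V_{0,v_0}|\phi_0\rangle$,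 $c_{\vec v}=\prod_{t=0}^T\alpha_{t,v_t}$, and $\|c\|_1=\sum_{\vec v}|c_{\vec v}|$. Thus $|\psi_{\vec m}\rangle=\sum_{\vec v}c_{\vec v}|\phi_{\vec m,\vec v}\rangle$. Random operator $\Omega$. (1) For each $i=1,\dots,k$, independently: for each $t=0,\dots,T$, independently sample an index $v$ with probability $|\alpha_{t,v}|/\|\alpha_t\|_1$ and set $W_{i,t}=(\alpha_{t,v}/|\alpha_{t,v}|)V_{t,v}$; for every $\vec m$ put $S_{i,\vec m}=W_{i,T}K_{T,m_T}\cdots W_{i,1}K_{1,m_1}W_{i,0}$ (the same sampled gates for all $\vec m$). (2) $S_{\vec m}=\frac{\|c\|_1}{k}\sum_{i=1}^kS_{i,\vec m}$. (3) $\Omega=\sum_{\vec m}S_{\vec m}|\phi_0\rangle\langle\phi_0|S_{\vec m}^\dagger$. The variance is over the random choices. *)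

(* Defs.v *)
From mathcomp Require Export all_boot all_order all_algebra.
From mathcomp Require Export mxtens.
From mathcomp Require Export complex.
From mathcomp Require Export all_classical all_reals all_analysis.

Set Implicit Arguments.
Unset Strict Implicit.
Unset Printing Implicit Defensive.

Import Order.TTheory GRing.Theory Num.Theory.

Local Open Scope ring_scope.
Local Open Scope complex_scope.
Local Open Scope sesquilinear_scope.

(** Complex absolute value as an element of [R] (the norm of [R[i]] itself
    takes its values in [R[i]]). *)
Definition cabs (R : realType) (z : R[i]) : R := complex.Re `|z|.

Definition braket (R : realType) (d : nat) (x y : 'cV[R[i]]_d) : R[i] :=
  (x ^t* *m y) 0 0.

Section Gaussian.
Variables (R : realType) (n : nat).

Definition pauliX : 'M[R[i]]_2 :=
  \matrix_(i, j) (if i == j then 0 else 1).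
Definition pauliY : 'M[R[i]]_2 :=
  \matrix_(i, j) (if i == j then 0 else if i == 0 then 0 -i* 1 else 0 +i* 1).
Definition pauliZ : 'M[R[i]]_2 :=
  \matrix_(i, j) (if i == j then (if i == 0 then 1 else - 1) else 0).

Lemma qubit_dim (j : 'I_n) : (2 ^ j * 2 * 2 ^ (n - j.+1) = 2 ^ n)%N.
Proof. by rewrite -expnSr -expnD subnKC. Qed.

(** [Z (x) ... (x) Z (x) A (x) I (x) ... (x) I], with [A] acting on qubit [j]
    (counted from 0). *)
Definition jw_string (A : 'M[R[i]]_2) (j : 'I_n) : 'M[R[i]]_(2 ^ n) :=
  castmx (qubit_dim j, qubit_dim j)
    (ntensmx pauliZ j *t A *t (1%:M : 'M[R[i]]_(2 ^ (n - j.+1)))).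

Lemma half_ltn (a : 'I_(2 * n)) : (a./2 < n)%N.
Proof. by rewrite ltn_half_double -mul2n. Qed.

(** The operators are counted from 0: index [2 * j] carries [X] on qubit [j],
    index [2 * j + 1] carries [Y] on qubit [j]. *)
Definition majorana (a : 'I_(2 * n)) : 'M[R[i]]_(2 ^ n) :=
  jw_string (if odd a then pauliY else pauliX) (Ordinal (half_ltn a)).

Definition gaussian_unitary (U : 'M[R[i]]_(2 ^ n)) : Prop :=
  U \is unitarymx /\
  exists2 O : 'M[R]_(2 * n), O *m O^T = 1%:M &
    forall a, U *m majorana a *m U ^t* = \sum_b (O a b)%:C *: majorana b.

(** [|0>^(x)n]; the cast identifies the width [1 ^ n] with [1]. *)
Definition ket0 : 'cV[R[i]]_(2 ^ n) :=
  castmx (erefl _, exp1n n) (ntensmx (delta_mx 0 0 : 'cV[R[i]]_2) n).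

Definition gaussian_state (psi : 'cV[R[i]]_(2 ^ n)) : Prop :=
  exists2 U, gaussian_unitary U & psi = U *m ket0.

(** A possibly subnormalized (hence possibly zero) Gaussian state is
    [z *: phi] with [phi] Gaussian and [|z| <= 1]. *)
Definition free_operator (K : 'M[R[i]]_(2 ^ n)) : Prop :=
  forall psi, gaussian_state psi ->
    exists z phi, [/\ cabs z <= 1, gaussian_state phi & K *m psi = z *: phi].

End Gaussian.

Section Circuit.
Variables (R : realType) (n T : nat).

Definition kraus_map (K : bool -> 'M[R[i]]_(2 ^ n)) (X : 'M[R[i]]_(2 ^ n)) :=
  \sum_(m : bool) K m *m X *m (K m) ^t*.

(** The gates have times [0, ..., T].  The adaptive channel applied between
    the gates of times [t] and [t.+1] has index [t : 'I_T], so that it is the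
    channel of time [t.+1].  It is completely positive because it is given in
    Kraus form. *)
Record adaptive_circuit := AdaptiveCircuit {
  gate : 'I_T.+1 -> 'M[R[i]]_(2 ^ n);
  nterms : 'I_T.+1 -> nat;
  coeff : forall t, 'I_(nterms t) -> R[i];
  gterm : forall t, 'I_(nterms t) -> 'M[R[i]]_(2 ^ n);
  kraus : 'I_T -> bool -> 'M[R[i]]_(2 ^ n);
  gate_unitary : forall t, gate t \is unitarymx;
  coeff_neq0 : forall t (v : 'I_(nterms t)), coeff v != 0;
  gterm_gaussian : forall t (v : 'I_(nterms t)), gaussian_unitary (gterm v);
  gate_decomposition :
    forall t, gate t = \sum_(v < nterms t) coeff v *: gterm v;
  kraus_free : forall t m, free_operator (kraus t m);
  kraus_trace_preserving : forall t X, \tr (kraus_map (kraus t) X) = \tr X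
}.

Variable E : adaptive_circuit.

Definition outcomes := {ffun 'I_T -> bool}.
Definition pattern := {dffun forall t : 'I_T.+1, 'I_(nterms E t)}.

(** [G_T K_(T, m_T) ... G_1 K_(1, m_1) G_0]; the enumeration of ['I_T] is
    increasing and [lift ord0 t] has value [t.+1]. *)
Definition branch (G : 'I_T.+1 -> 'M[R[i]]_(2 ^ n)) (m : outcomes) :
    'M[R[i]]_(2 ^ n) :=
  foldl (fun A t => G (lift ord0 t) *m kraus E t (m t) *m A)
    (G ord0) (enum 'I_T).

Definition coeff_norm1 (t : 'I_T.+1) : R :=
  \sum_(v < nterms E t) cabs (coeff v).

Definition pcoeff (v : pattern) : R[i] := \prod_t coeff (v t).
Definition pcoeff_norm1 : R := \sum_(v : pattern) cabs (pcoeff v).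

Variable phi0 : 'cV[R[i]]_(2 ^ n).

Definition psi_out (m : outcomes) : 'cV[R[i]]_(2 ^ n) :=
  branch (gate E) m *m phi0.
Definition phi_out (m : outcomes) (v : pattern) : 'cV[R[i]]_(2 ^ n) :=
  branch (fun t => gterm (v t)) m *m phi0.

Definition Ctilde : R :=
  pcoeff_norm1 * \sum_(w : pattern) cabs (pcoeff w) *
    cabs (\sum_(m : outcomes) braket (psi_out m) (phi_out m w)) ^+ 2.

(** The random operator as a function of the indices [x i t] drawn for the
    [i]-th copy at time [t]. *)
Variables (k : nat) (x : 'I_k -> forall t : 'I_T.+1, 'I_(nterms E t)).

Definition sampled_gate (i : 'I_k) (t : 'I_T.+1) : 'M[R[i]]_(2 ^ n) :=
  (coeff (x i t) / `|coeff (x i t)|) *: gterm (x i t).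

Definition sparsified_kraus (m : outcomes) : 'M[R[i]]_(2 ^ n) :=
  (pcoeff_norm1 / k%:R)%:C *: \sum_(i < k) branch (sampled_gate i) m.

Definition Omega : 'M[R[i]]_(2 ^ n) :=
  \sum_(m : outcomes)
    sparsified_kraus m *m (phi0 *m phi0 ^t*) *m (sparsified_kraus m) ^t*.

(** [Omega] is positive semidefinite, so taking the real part of its trace
    only changes the type. *)
Definition trOmega : R := complex.Re (\tr Omega).

End Circuit.

Section Sampling.
Variables (R : realType) (d : measure_display) (W : measurableType d).
Variable P : probability W R.

(** Mutual independence of a finite family of finitely-valued random
    variables. *)
Definition mutually_independent (J : finType) (I : J -> finType)
    (X : forall j, W -> I j) : Prop :=
  forall (A : {set J}) (x : forall j, I j),
    P [set w | forall j, j \in A -> X j w = x j]%classic =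
    (\prod_(j in A) P [set w | X j w = x j]%classic)%E.

Definition sampling_scheme (n T k : nat) (E : adaptive_circuit R n T)
    (v : 'I_k -> forall t : 'I_T.+1, W -> 'I_(nterms E t)) : Prop :=
  [/\ forall i t a, measurable [set w | v i t w = a]%classic,
      forall i t a, P [set w | v i t w = a]%classic =
        (cabs (coeff a) / coeff_norm1 E t)%:E
    & @mutually_independent ('I_k * 'I_T.+1)%type
        (fun j => 'I_(nterms E j.2)) (fun j => v j.1 j.2)].

End Sampling.

(* Main.v *)
(** Regard the branches as one vector, [Psi = (psi_m)_m] and [Phi_v = (phi_(m,v))_m]
    in an orthogonal sum over the outcomes [m], so that [|Psi| = |Phi_v| = 1].
    Sampling a pattern [v] with probability [|c_v| / c], where [c = |c|_1], the
    vector [X_v = c (c_v / |c_v|) Phi_v] has mean [Psi] and norm [c], and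
    [Tr Omega = |X_1 + ... + X_k|^2 / k^2] for [k] independent copies.  Up to a
    constant this is a U-statistic with kernel [h v w = Re <X_v, X_w>], whose
    variance follows from the Hoeffding decomposition of [h]: the projection
    [Re <Psi, X_v> - 1] has second moment at most [Ctilde - 1], and [h^2 <= c^4]
    by Cauchy-Schwarz. *)
Require Import Defs.
From mathcomp Require Import all_boot all_order all_algebra.
From mathcomp Require Import complex ring lra.
From mathcomp Require Import all_classical all_reals all_analysis.

Set Implicit Arguments.
Unset Strict Implicit.
Unset Printing Implicit Defensive.
Import Order.TTheory GRing.Theory Num.Theory.
Local Open Scope ring_scope.

(** * Finite product measures and resampling of a single coordinate *)

Section Resampling.
Variables (I : finType) (T : I -> finType) (K : comNzRingType).
Local Notation point := {dffun forall i, T i}.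

Definition update (y : point) (i : I) (a : T i) : point :=
  [ffun j => eqtype.dfwith (fun l => y l) a j].

Lemma update_in y i (a : T i) : update y a i = a.
Proof. by rewrite ffunE eqtype.dfwith_in. Qed.

Lemma update_out y i (a : T i) j : j != i -> update y a j = y j.
Proof. by rewrite eq_sym => ij; rewrite ffunE eqtype.dfwith_out. Qed.

Lemma updateK y i (a : T i) : update (update y a) (y i) = y.
Proof.
apply/ffunP => j; case: (eqVneq j i) => [->|ij]; first by rewrite update_in.
by rewrite !update_out.
Qed.

Lemma sum_prod_dffun (p : forall i, T i -> K) :
  \sum_(y : point) \prod_i p i (y i) = \prod_i \sum_(a : T i) p i a.
Proof.
rewrite (reindex (@dffun_of_fprod I T)) /=; last first.
  exact/onW_bij/dffun_of_fprod_bij.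
transitivity (\sum_(t : fprod T) \prod_i [ffun a => p i a] (t i)).
  by apply: eq_bigr => t _; apply: eq_bigr => i _; rewrite !ffunE.
rewrite (big_fprod 1 +%R (fun i => [ffun a => p i a])).
rewrite -(bigA_distr_big_dep _ (fun i u => untag 0 [ffun a => p i a] u)).
apply: eq_bigr => i _; rewrite -(big_tag (fun i => [ffun a => p i a])).
by apply: eq_bigr => a _; rewrite ffunE.
Qed.

Variable p : forall i, T i -> K.
Definition point_weight (y : point) : K := \prod_i p (y i).

(** Exchanging one coordinate with an independent fresh copy preserves a product law. [F] takes
    values in a module because the fact serves both scalar means and operator-valued branches. *)
Lemma sum_resample (V : lmodType K) (F : point -> V) (i : I) :
  \sum_(a : T i) p a = 1 ->
  \sum_y point_weight y *: F y =
  \sum_y point_weight y *: \sum_(a : T i) p a *: F (update y a).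
Proof.
move=> p1; symmetry.
under eq_bigr => y _ do rewrite scaler_sumr.
rewrite pair_bigA /=.
(* The involution [(y, a) |-> (update y a, y i)] preserves the weights. *)
pose s (u : point * T i) := (update u.1 u.2, u.1 i).
have sK : involutive s.
  by case=> y a; rewrite /s /= updateK update_in.
rewrite (reindex_inj (inv_inj sK)) /=.
transitivity (\sum_(u : point * T i) (p u.2 * point_weight u.1) *: F u.1).
  apply: eq_bigr => -[y a] _ /=; rewrite updateK scalerA; congr (_ *: _).
  rewrite /point_weight (bigD1 i) //= [in RHS](bigD1 i) //= update_in.
  rewrite -mulrA; congr (_ * _); rewrite mulrC; congr (_ * _).
  by apply: eq_bigr => j ji; rewrite update_out.
rewrite -(pair_bigA _ (fun y a => (p a * point_weight y) *: F y)) /=.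
apply: eq_bigr => y _; rewrite -scaler_suml -mulr_suml p1 mul1r //.
Qed.

End Resampling.

(** * Hoeffding decomposition and variance of a U-statistic of order two *)

Section UStatistic.
Variables (R : comNzRingType) (V : finType) (q : V -> R) (k : nat).
Hypothesis q1 : \sum_a q a = 1.
Local Notation sample := {dffun forall i : 'I_k, V}.

Definition sample_mean (F : sample -> R) : R :=
  \sum_(y : sample) point_weight (fun _ => q) y * F y.

Lemma sample_mean_cst c : sample_mean (fun=> c) = c.
Proof.
rewrite /sample_mean -mulr_suml sum_prod_dffun.
by rewrite big1 ?mul1r.
Qed.

Lemma sample_meanD F G :
  sample_mean (fun y => F y + G y) = sample_mean F + sample_mean G.
Proof. by rewrite -big_split; apply: eq_bigr => y _; rewrite mulrDr. Qed.

Lemma sample_meanZ c F : sample_mean (fun y => c * F y) = c * sample_mean F.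
Proof. by rewrite mulr_sumr; apply: eq_bigr => y _; rewrite mulrCA. Qed.

Lemma sample_mean_sum (J : finType) (F : J -> sample -> R) :
  sample_mean (fun y => \sum_j F j y) = \sum_j sample_mean (F j).
Proof. by rewrite exchange_big; apply: eq_bigr => y _; rewrite mulr_sumr. Qed.

Lemma eq_sample_mean F G : F =1 G -> sample_mean F = sample_mean G.
Proof. by move=> FG; apply: eq_bigr => y _; rewrite FG. Qed.

Lemma sample_mean_resample (i : 'I_k) F :
  sample_mean F = sample_mean (fun y => \sum_a q a * F (update y (i := i) a)).
Proof. exact: (sum_resample (F : sample -> R^o) (i := i) q1). Qed.

Lemma sample_mean1 (i : 'I_k) (f : V -> R) :
  sample_mean (fun y => f (y i)) = \sum_a q a * f a.
Proof.
rewrite (sample_mean_resample i) -[RHS]sample_mean_cst.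
by apply: eq_sample_mean => y; apply: eq_bigr => a _; rewrite update_in.
Qed.

Lemma sample_mean2 (i j : 'I_k) (f : V -> V -> R) : i != j ->
  sample_mean (fun y => f (y i) (y j)) = \sum_a \sum_b q a * q b * f a b.
Proof.
move=> ij; rewrite (sample_mean_resample i).
transitivity (sample_mean (fun y => \sum_a q a * f a (y j))).
  apply: eq_sample_mean => y; apply: eq_bigr => a _.
  by rewrite update_in update_out // eq_sym.
rewrite sample_mean_sum; apply: eq_bigr => a _.
rewrite sample_meanZ sample_mean1 mulr_sumr.
by apply: eq_bigr => b _; rewrite mulrA.
Qed.

Lemma sample_mean_sqr_sum (J : finType) (Z : J -> sample -> R) :
  (forall i j, i != j -> sample_mean (fun y => Z i y * Z j y) = 0) ->
  sample_mean (fun y => (\sum_j Z j y) ^+ 2) =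
  \sum_j sample_mean (fun y => Z j y ^+ 2).
Proof.
move=> Z0.
transitivity (sample_mean (fun y => \sum_i \sum_j Z i y * Z j y)).
  apply: eq_sample_mean => y; rewrite expr2 mulr_suml.
  by apply: eq_bigr => i _; rewrite mulr_sumr.
rewrite sample_mean_sum; apply: eq_bigr => i _.
rewrite sample_mean_sum (bigD1 i) //= big1 ?addr0 // => j ji.
by apply: Z0; rewrite eq_sym.
Qed.

Lemma sum_off_const (i : 'I_k) (x : R) :
  \sum_(j < k | j != i) x = (k%:R - 1) * x.
Proof.
have := sumr_const 'I_k x.
rewrite card_ord (bigD1 i) //= => /(canRL (addKr _)) ->.
by rewrite -mulr_natl; ring.
Qed.

(** The swap matches the pairs above the diagonal with those below. Listing each unordered pair once
    is what makes the Hoeffding components orthogonal later. *)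
Lemma sum_offdiag_sym (f : 'I_k -> 'I_k -> R) : (forall i j, f i j = f j i) ->
  \sum_i \sum_(j | j != i) f i j =
  2%:R * \sum_(p : 'I_k * 'I_k | (p.1 < p.2)%N) f p.1 p.2.
Proof.
move=> fC; rewrite pair_big_dep /=.
rewrite (bigID (fun p : 'I_k * 'I_k => (p.1 < p.2)%N)) /= mulr_natl mulr2n.
congr (_ + _).
  by apply: eq_bigl => -[i j] /=; rewrite neq_ltn; case: ltngtP.
have swapK : involutive (fun p : 'I_k * 'I_k => (p.2, p.1)) by case.
rewrite (reindex_inj (inv_inj swapK)).
apply: eq_big => [[i j]|[i j] _] /=; last exact: fC.
by rewrite neq_ltn; case: ltngtP.
Qed.

Variables (h : V -> V -> R) (c : R).
Hypotheses (hC : forall a b, h a b = h b a) (hd : forall a, h a a = c).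

(* [h a b = mu + g a + g b + r a b] is the Hoeffding decomposition: [g] has
   mean [0], and [r] has mean [0] in each argument. *)
Let mu := \sum_a \sum_b q a * q b * h a b.
Let g a := \sum_b q b * h a b - mu.
Let r a b := h a b - g a - g b - mu.

Let sum_q (x : R) : \sum_a q a * x = x.
Proof. by rewrite -mulr_suml q1 mul1r. Qed.

Let qg0 : \sum_a q a * g a = 0.
Proof.
under eq_bigr do rewrite mulrBr.
rewrite big_split /= sumrN sum_q /mu.
apply/eqP; rewrite subr_eq0; apply/eqP/eq_bigr => a _; rewrite mulr_sumr.
by apply: eq_bigr => b _; rewrite mulrA.
Qed.

Let rC a b : r a b = r b a.
Proof. by rewrite /r hC; ring. Qed.

Let qr0 b : \sum_a q a * r a b = 0.
Proof.
rewrite (eq_bigr (fun a => q a * h b a - q a * g a - q a * (g b + mu))).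
  by rewrite !big_split /= !sumrN qg0 sum_q /g; ring.
by move=> a _; rewrite /r hC; ring.
Qed.

(** The components of half the centered off-diagonal sum. Each [g (y i)] meets [k - 1] partners;
    pairs not in increasing order get the default 0, so that no unordered pair counts twice. *)
Let term (z : 'I_k + 'I_k * 'I_k) (y : sample) : R :=
  match z with
  | inl i => (k%:R - 1) * g (y i)
  | inr p => if (p.1 < p.2)%N then r (y p.1) (y p.2) else 0
  end.

Lemma pair_sum_hoeffding (y : sample) :
  \sum_i \sum_j h (y i) (y j) =
  k%:R * (k%:R - 1) * mu + k%:R * c + 2%:R * \sum_z term z y.
Proof.
transitivity (\sum_i (c + (k%:R - 1) * (mu + g (y i)) +
    \sum_(j < k | j != i) g (y j)) + \sum_i \sum_(j | j != i) r (y i) (y j)).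
  rewrite -big_split; apply: eq_bigr => i _ /=.
  rewrite (bigD1 i) //= hd -addrA -addrA -(sum_off_const i) -!big_split /=.
  congr (_ + _).
  by apply: eq_bigr => j _; rewrite /r; ring.
rewrite sum_offdiag_sym; last by move=> i j; exact: rC.
rewrite big_sumType /= -big_mkcond [2%:R * (_ + _)]mulrDr addrA; congr (_ + _).
rewrite !big_split /= -!mulr_sumr big_split /= !sumr_const card_ord.
(* The exchange yields a second copy of the linear part [(k - 1) g (y j)], whence the factor 2 in
   front of the components. *)
rewrite (exchange_big_dep predT) //=.
rewrite [X in _ + X = _](eq_bigr (fun j => (k%:R - 1) * g (y j))); last first.
  move=> j _; rewrite -(sum_off_const j); by apply: eq_bigl => i; rewrite eq_sym.
by rewrite -mulr_sumr -(mulr_natl c) -(mulr_natl mu); ring.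
Qed.

(** Unless a default 0 occurs, one of the two components depends on a coordinate that the other
    ignores. Resampling this coordinate averages the product to 0, as [g] and [r] have mean 0 in
    each argument. *)
Lemma term_orthogonal z z' : z != z' ->
  sample_mean (fun y => term z y * term z' y) = 0.
Proof.
have pair0 (i j : 'I_k) (f : sample -> R) : i != j ->
    (forall y a, f (update y (i := i) a) = f y) ->
    sample_mean (fun y => f y * r (y i) (y j)) = 0.
  move=> ij fi; rewrite (sample_mean_resample i) -[RHS]sample_mean_cst.
  apply: eq_sample_mean => y.
  under eq_bigr => a _ do rewrite fi update_in update_out 1?eq_sym // mulrCA.
  by rewrite -mulr_sumr qr0 mulr0.
have one0 (i : 'I_k) (f : sample -> R) :
    (forall y a, f (update y (i := i) a) = f y) ->
    sample_mean (fun y => f y * g (y i)) = 0.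
  move=> fi; rewrite (sample_mean_resample i) -[RHS]sample_mean_cst.
  apply: eq_sample_mean => y.
  under eq_bigr => a _ do rewrite fi update_in mulrCA.
  by rewrite -mulr_sumr qg0 mulr0.
have pair0' (i j : 'I_k) (f : sample -> R) : i != j ->
    (forall y a, f (update y (i := j) a) = f y) ->
    sample_mean (fun y => f y * r (y i) (y j)) = 0.
  move=> ij fj; have ji : j != i by rewrite eq_sym.
  rewrite -(pair0 j i f ji fj).
  by apply: eq_sample_mean => y; rewrite rC.
have mixed0 (i : 'I_k) (p : 'I_k * 'I_k) :
    sample_mean (fun y => term (inl i) y * term (inr p) y) = 0.
  case: p => u w /=; case: (ltnP u w) => [uw|_]; last first.
    by rewrite -[RHS]sample_mean_cst; apply: eq_sample_mean => y; rewrite mulr0.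
  have neq_uw : u != w by rewrite neq_ltn uw.
  case: (eqVneq i u) => [->|iu].
    by apply: pair0' => // y a; rewrite update_out.
  by apply: pair0 => // y a; rewrite update_out.
case: z z' => [i|p] [j|p'] zz'.
- rewrite /= -[RHS](one0 j (fun y => (k%:R - 1) ^+ 2 * g (y i))).
    by apply: eq_sample_mean => y; ring.
  by move=> y a; rewrite update_out //; apply: contraNneq zz' => ->.
- exact: mixed0.
- by rewrite -[RHS](mixed0 j p); apply: eq_sample_mean => y; rewrite mulrC.
- case: p p' zz' => [u w] [u' w'] zz' /=.
  case: (ltnP u w) => uw; last first.
    by rewrite -[RHS]sample_mean_cst; apply: eq_sample_mean => y; rewrite mul0r.
  case: (ltnP u' w') => uw'; last first.
    by rewrite -[RHS]sample_mean_cst; apply: eq_sample_mean => y; rewrite mulr0.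
  have neq_uw : u' != w' by rewrite neq_ltn uw'.
  case: (boolP ((u' == u) || (u' == w))) => [u'in|]; last first.
    rewrite negb_or => /andP[u'u u'w].
    by apply: pair0 => // y a; rewrite !update_out // eq_sym.
  case: (boolP ((w' == u) || (w' == w))) => [w'in|]; last first.
    rewrite negb_or => /andP[w'u w'w].
    by apply: pair0' => // y a; rewrite !update_out // eq_sym.
  (* Both entries of the second pair lie in the first; as both pairs increase, they would be
     equal. *)
  case/negP: zz'; case/orP: u'in => /eqP eu; case/orP: w'in => /eqP ew; subst u' w'.
  + by rewrite ltnn in uw'.
  + by [].
  + by rewrite ltnNge (ltnW uw) in uw'.
  + by rewrite ltnn in uw'.
Qed.

Let g2 := \sum_a q a * g a ^+ 2.

(** Pythagoras for [h a b = mu + g a + g b + r a b]: the four parts are orthogonal, and the two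
    linear ones contribute [g2] each. *)
Lemma mean_sqr_remainder :
  \sum_a \sum_b q a * q b * r a b ^+ 2 =
  \sum_a \sum_b q a * q b * h a b ^+ 2 - mu ^+ 2 - 2%:R * g2.
Proof.
(* Every cross term with [r] is grouped so that an inner sum is a mean of [r] in one argument, which
   vanishes by [qr0]; the rest is handled by [qg0]. *)
have -> : \sum_a \sum_b q a * q b * h a b ^+ 2 =
    \sum_a \sum_b (q a * q b * r a b ^+ 2 +
      2%:R * (g a + mu) * q a * (q b * r b a)) +
    \sum_b \sum_a 2%:R * q b * g b * (q a * r a b) +
    \sum_a (q a * (g a ^+ 2 + 2%:R * g a * mu + mu ^+ 2) +
      \sum_b (q a * (q b * g b ^+ 2) + 2%:R * (g a + mu) * q a * (q b * g b))).
  rewrite [X in _ + X + _]exchange_big -!big_split; apply: eq_bigr => a _ /=.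
  rewrite -(sum_q (q a * (g a ^+ 2 + 2%:R * g a * mu + mu ^+ 2))) -!big_split.
  apply: eq_bigr => b _ /=.
  by rewrite (rC b a) /r; ring.
rewrite [X in _ = _ + X + _ - _ - _]big1 => [|b _]; last first.
  by rewrite -mulr_sumr qr0 mulr0.
rewrite [X in _ = X + 0 + _ - _ - _](eq_bigr
    (fun a => \sum_b q a * q b * r a b ^+ 2)); last first.
  by move=> a _; rewrite big_split /= -mulr_sumr qr0 mulr0 addr0.
rewrite [X in _ = _ + 0 + X - _ - _](eq_bigr (fun a => q a * g a ^+ 2 +
    2%:R * mu * (q a * g a) + q a * mu ^+ 2 + q a * g2)); last first.
  by move=> a _; rewrite big_split /= -!mulr_sumr qg0 -/g2; ring.
by rewrite !big_split /= -mulr_sumr qg0 !sum_q /g2; ring.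
Qed.

Lemma sample_mean_pair_sum :
  sample_mean (fun y => \sum_i \sum_j h (y i) (y j)) =
  k%:R * (k%:R - 1) * mu + k%:R * c.
Proof.
under eq_sample_mean do rewrite pair_sum_hoeffding.
rewrite sample_meanD sample_mean_cst sample_meanZ sample_mean_sum.
rewrite big1 ?mulr0 ?addr0 // => -[i|[u w]] _ /=.
  by rewrite sample_meanZ sample_mean1 qg0 mulr0.
rewrite /term /=; case: (ltnP u w) => uw; last by rewrite sample_mean_cst.
rewrite sample_mean2 ?neq_ltn ?uw // exchange_big big1 //= => b _.
under eq_bigr do rewrite mulrAC.
by rewrite -mulr_suml qr0 mul0r.
Qed.

(** By orthogonality the variance is 4 times the sum of [k] linear contributions [(k - 1)^2 g2] and
    [k (k - 1) / 2] contributions of [r]. The [- 2 g2] in the second moment of [r] turns one factor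
    [k - 1] into [k - 2]. *)
Lemma sample_variance_pair_sum :
  sample_mean (fun y => (\sum_i \sum_j h (y i) (y j)
                          - (k%:R * (k%:R - 1) * mu + k%:R * c)) ^+ 2) =
  4%:R * k%:R * (k%:R - 1) * (k%:R - 2%:R) * g2 +
  2%:R * k%:R * (k%:R - 1) *
    (\sum_a \sum_b q a * q b * h a b ^+ 2 - mu ^+ 2).
Proof.
transitivity (4%:R * sample_mean (fun y => (\sum_z term z y) ^+ 2)).
  rewrite -sample_meanZ; apply: eq_sample_mean => y.
  by rewrite pair_sum_hoeffding; ring.
rewrite sample_mean_sqr_sum; last exact: term_orthogonal.
rewrite big_sumType /=.
rewrite (eq_bigr (fun=> (k%:R - 1) ^+ 2 * g2)); last first.
  move=> i _; under eq_sample_mean do rewrite exprMn.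
  by rewrite sample_meanZ (sample_mean1 i (fun a => g a ^+ 2)).
pose rho := \sum_a \sum_b q a * q b * r a b ^+ 2.
rewrite [X in 4%:R * (_ + X)](eq_bigr
    (fun p : 'I_k * 'I_k => if (p.1 < p.2)%N then rho else 0)); last first.
  move=> p _; case: (ltnP p.1 p.2) => p12; last by rewrite expr0n sample_mean_cst.
  by rewrite (sample_mean2 (fun a b => r a b ^+ 2)) // neq_ltn p12.
rewrite -big_mkcond /=.
have pairs_rho : k%:R * (k%:R - 1) * rho =
    2%:R * \sum_(p : 'I_k * 'I_k | (p.1 < p.2)%N) rho.
  rewrite -(@sum_offdiag_sym (fun _ _ => rho)) //.
  under eq_bigr => i _ do rewrite sum_off_const.
  by rewrite sumr_const card_ord -(mulr_natl ((k%:R - 1) * rho)) mulrA.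
rewrite mulrDr sumr_const card_ord -(mulr_natl ((k%:R - 1) ^+ 2 * g2)).
rewrite [4%:R * \sum_(_ | _) _]
  (_ : _ = 2%:R * (k%:R * (k%:R - 1) * rho)); last first.
  by rewrite pairs_rho; ring.
by rewrite /rho mean_sqr_remainder; ring.
Qed.

End UStatistic.

(** * Expectation and variance of functions of a finitely-valued random variable *)

Section FiniteRV.
Variables (R : realType) (d : measure_display) (W : measurableType d).
Variable P : probability W R.
Variables (I : finType) (Y : W -> I) (p : I -> R).
Hypotheses (mY : forall a, measurable [set w | Y w = a]%classic)
  (pY : forall a, P [set w | Y w = a]%classic = (p a)%:E).

Lemma expectation_finite_rv (f : I -> R) :
  ('E_P[fun w => f (Y w)] = (\sum_a p a * f a)%:E)%E.
Proof.
rewrite unlock.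
(* [f (Y w)] is a finite combination of the indicators of the fibers of [Y]. *)
transitivity (\int[P]_w
  (\sum_a ((\1_([set w | Y w = a]%classic) w)%:E * (f a)%:E)))%E.
  apply: eq_integral => w _.
  rewrite (bigD1 (Y w)) //= big1 => [|a aY]; last first.
    by rewrite indicE memNset ?mul0e // => Ya; rewrite -Ya eqxx in aY.
  by rewrite indicE mem_set // mul1e adde0.
rewrite integral_sum //; last first.
  by move=> a; apply: integrableZr => //; exact: integrable_indic.
rewrite -sumEFin; apply: eq_bigr => a _.
rewrite integralZr //; last exact: integrable_indic.
by rewrite integral_indic // setIT EFinM -pY.
Qed.

Lemma variance_finite_rv (f : I -> R) :
  ('V_P[fun w => f (Y w)] =
   (\sum_a p a * (f a - \sum_b p b * f b) ^+ 2)%:E)%E.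
Proof.
rewrite /variance unlock expectation_finite_rv /=.
exact: (expectation_finite_rv (fun a => (f a - \sum_b p b * f b) ^+ 2)).
Qed.

End FiniteRV.

(** * The joint law of the sampled patterns *)

Section SampledPatterns.
Variables (R : realType) (d : measure_display) (W : measurableType d).
Variables (P : probability W R) (n T k : nat) (E : adaptive_circuit R n T).
Variable v : 'I_k -> forall t : 'I_T.+1, W -> 'I_(nterms E t).
Hypothesis sv : sampling_scheme P v.

(** Gathering all drawn indices in one point of a finite type makes the trace of [Omega] a function
    of a single finitely-valued variable. *)
Definition patterns_at (w : W) : {dffun forall i : 'I_k, pattern E} :=
  [ffun i => [ffun t => v i t w]].

(** This is the event of [mutually_independent] for the full index set, so the joint law is a
    product. *)
Let fiberE (y : {dffun forall i : 'I_k, pattern E}) :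
  [set w | patterns_at w = y]%classic =
  [set w | forall j : 'I_k * 'I_T.+1, j \in [set: 'I_k * 'I_T.+1]%SET ->
    v j.1 j.2 w = y j.1 j.2]%classic.
Proof.
apply/seteqP; split => w /=.
  by move=> <- [i t] _ /=; rewrite !ffunE.
move=> vy; apply/ffunP => i; apply/ffunP => t; rewrite !ffunE.
by apply: (vy (i, t)); rewrite inE.
Qed.

Lemma measurable_patterns_at y : measurable [set w | patterns_at w = y]%classic.
Proof.
have [mv _ _] := sv; rewrite fiberE.
rewrite (_ : [set w | _]%classic = (\bigcap_(j in [set: 'I_k * 'I_T.+1])
  [set w | v j.1 j.2 w = y j.1 j.2])%classic); last first.
  apply/seteqP; split => w /=.
    by move=> vy j _; apply: vy; rewrite inE.
  by move=> vy j _; exact: vy.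
by apply: fin_bigcap_measurable => // j _; exact: mv.
Qed.

Lemma probability_patterns_at y :
  P [set w | patterns_at w = y]%classic =
  (\prod_i \prod_t (cabs (coeff (y i t)) / coeff_norm1 E t))%:E.
Proof.
have [mv pv iv] := sv; rewrite fiberE.
apply: etrans (iv [set: 'I_k * 'I_T.+1]%SET (fun j => y j.1 j.2)) _.
rewrite pair_big /= -prodEFin; apply: eq_big => [j|j _]; first by rewrite inE.
exact: pv.
Qed.

End SampledPatterns.

(** * Complex moduli and the inner product *)

Section Braket.
Variables (R : realType) (d : nat).
Local Notation C := R[i].
Local Open Scope complex_scope.
Local Open Scope sesquilinear_scope.
Implicit Types (x y : 'cV[C]_d).

Lemma complex_ReD (z w : C) : complex.Re (z + w) = complex.Re z + complex.Re w.
Proof. by case: z w => a b [c e]. Qed.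

Lemma complex_ReMl (a : R) (z : C) : complex.Re (a%:C * z) = a * complex.Re z.
Proof. by case: z => b c; simpc. Qed.

Lemma complex_Re_sum (J : finType) (F : J -> C) :
  complex.Re (\sum_j F j) = \sum_j complex.Re (F j).
Proof. exact: (big_morph _ complex_ReD). Qed.

Lemma cabsE (z : C) : (cabs z)%:C = `|z|.
Proof. by rewrite /cabs normc_def. Qed.

Lemma cabs_ge0 (z : C) : 0 <= cabs z.
Proof. by rewrite -ler0c cabsE. Qed.

Lemma cabs_eq0 (z : C) : (cabs z == 0) = (z == 0).
Proof. by rewrite -(inj_eq (@complexI R)) cabsE normr_eq0. Qed.

Lemma cabsM (z w : C) : cabs (z * w) = cabs z * cabs w.
Proof. by apply: complexI; rewrite rmorphM /= !cabsE normrM. Qed.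

Lemma cabs_prod (J : finType) (F : J -> C) : cabs (\prod_j F j) = \prod_j cabs (F j).
Proof.
apply: complexI; rewrite cabsE normr_prod rmorph_prod.
by apply: eq_bigr => j _; rewrite /= cabsE.
Qed.

Lemma cabs_real (a : R) : 0 <= a -> cabs a%:C = a.
Proof. by move=> a0; apply: complexI; rewrite cabsE ger0_norm // ler0c. Qed.

Lemma cabs_sign (z : C) : z != 0 -> cabs (z / `|z|) = 1.
Proof.
move=> z0; apply: complexI; rewrite cabsE normrM normrV ?unitfE ?normr_eq0 //.
by rewrite normr_id divff // normr_eq0.
Qed.

Lemma complex_Re_sqr_le (z : C) : complex.Re z ^+ 2 <= cabs z ^+ 2.
Proof.
rewrite -lecR !rmorphXn /= cabsE -add_Re2_Im2 -rmorphXn /= lecR.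
by rewrite lerDl sqr_ge0.
Qed.

Lemma adjmxM (m n p : nat) (A : 'M[C]_(m, n)) (B : 'M[C]_(n, p)) :
  (A *m B) ^t* = B ^t* *m A ^t*.
Proof. by rewrite trmx_mul map_mxM. Qed.

Lemma braketE x y : braket x y = \sum_i conjc (x i 0) * y i 0.
Proof. by rewrite /braket mxE; apply: eq_bigr => i _; rewrite !mxE. Qed.

Lemma braketC x y : braket y x = conjc (braket x y).
Proof.
rewrite !braketE rmorph_sum; apply: eq_bigr => i _.
by rewrite rmorphM /= conjcK mulrC.
Qed.

Lemma braketZr (a : C) x y : braket x (a *: y) = a * braket x y.
Proof. by rewrite /braket -scalemxAr mxE. Qed.

Lemma braketZl (a : C) x y : braket (a *: x) y = conjc a * braket x y.
Proof. by rewrite braketC braketZr rmorphM [in RHS]braketC. Qed.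

Lemma braket_sumr (J : finType) x (F : J -> 'cV[C]_d) :
  braket x (\sum_j F j) = \sum_j braket x (F j).
Proof. by rewrite /braket mulmx_sumr summxE. Qed.

Lemma braket_suml (J : finType) y (F : J -> 'cV[C]_d) :
  braket (\sum_j F j) y = \sum_j braket (F j) y.
Proof.
rewrite braketC braket_sumr rmorph_sum.
by apply: eq_bigr => j _; rewrite [RHS]braketC.
Qed.

Lemma Re_braket_ge0 x : 0 <= complex.Re (braket x x).
Proof.
rewrite braketE complex_Re_sum sumr_ge0 // => i _.
by case: (x i 0) => a b; simpc; rewrite -!expr2 addr_ge0 ?sqr_ge0.
Qed.

Lemma cabsJ (z : C) : cabs (conjc z) = cabs z.
Proof. by rewrite /cabs normcJ. Qed.

Lemma complex_Re_conj (z : C) : complex.Re (conjc z) = complex.Re z.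
Proof. by case: z. Qed.

Lemma Re_braketC x y : complex.Re (braket x y) = complex.Re (braket y x).
Proof. by rewrite braketC complex_Re_conj. Qed.

Lemma Re_braket_combine (e : R) x y :
  complex.Re (braket (x + e%:C *: y) (x + e%:C *: y)) =
  complex.Re (braket x x) + 2%:R * e * complex.Re (braket x y)
  + e ^+ 2 * complex.Re (braket y y).
Proof.
have addr_br u w w' : braket (u : 'cV[C]_d) (w + w') = braket u w + braket u w'.
  by rewrite /braket mulmxDr mxE.
have addl_br u w w' : braket (w + w') (u : 'cV[C]_d) = braket w u + braket w' u.
  by rewrite braketC addr_br rmorphD (braketC u w) (braketC u w').
rewrite addl_br !addr_br !braketZl !braketZr conjc_real !complex_ReD !complex_ReMl.
by rewrite (braketC x y) complex_Re_conj; ring.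
Qed.

(** Cauchy-Schwarz in an orthogonal sum, for vectors of equal norm: the squared norms of [x + y] and
    [x - y] are nonnegative, which bounds the inner product by [c] on both sides. *)
Lemma sum_Re_braket_sqr_le (J : finType) (x y : J -> 'cV[C]_d) (c : R) :
  \sum_j complex.Re (braket (x j) (x j)) = c ->
  \sum_j complex.Re (braket (y j) (y j)) = c ->
  (\sum_j complex.Re (braket (x j) (y j))) ^+ 2 <= c ^+ 2.
Proof.
move=> xc yc; set s := \sum_j complex.Re (braket (x j) (y j)).
have nonneg (e : R) : 0 <= c + 2%:R * e * s + e ^+ 2 * c.
  rewrite -{1}xc -yc /s !mulr_sumr -!big_split sumr_ge0 // => j _ /=.
  by rewrite -Re_braket_combine Re_braket_ge0.
have /andP[lo hi] : - c <= s <= c.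
  by have := nonneg 1; have := nonneg (- 1); lra.
by rewrite -[leLHS]real_normK ?num_real // lerXn2r ?nnegrE // ?ler_norml ?lo //; lra.
Qed.

Lemma mxtrace_outer (x : 'cV[C]_d) : \tr (x *m x ^t*) = braket x x.
Proof. by rewrite mxtrace_mulC /mxtrace big_ord1. Qed.

Lemma mxtrace_conj_outer (m : nat) (A : 'M[C]_(m, d)) x :
  \tr (A *m (x *m x ^t*) *m A ^t*) = braket (A *m x) (A *m x).
Proof.
by rewrite -mulmxA -mulmxA -adjmxM mulmxA [LHS]mxtrace_mulC /mxtrace big_ord1.
Qed.

Lemma braket_unitary (U : 'M[C]_d) x y :
  U \is unitarymx -> braket (U *m x) (U *m y) = braket x y.
Proof.
move=> /unitarymxP /mulmx1C UU.
by rewrite /braket adjmxM -mulmxA (mulmxA _ U) UU mul1mx.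
Qed.

End Braket.

(** * Normalization of Gaussian states *)

Section Ket0.
Variable R : realType.
Local Notation C := R[i].
Local Open Scope complex_scope.
Local Open Scope sesquilinear_scope.

(** Rectangular matrices are allowed because a unit column is an isometry from dimension 1. *)
Lemma tensmx_isometry (m n p q : nat) (A : 'M[C]_(m, n)) (B : 'M[C]_(p, q)) :
  A ^t* *m A = 1%:M -> B ^t* *m B = 1%:M ->
  (A *t B) ^t* *m (A *t B) = 1%:M.
Proof.
move=> AA BB; rewrite trmx_tens map_mxT tensmx_mul AA BB.
apply/matrixP => i j.
case: (mxtens_indexP i) => i0 i1; case: (mxtens_indexP j) => j0 j1.
rewrite tensmxE !mxE (can_eq (@mxtens_indexK _ _)) xpair_eqE.
by rewrite -natrM mulnb.
Qed.

Lemma ntensmx_isometry (m p : nat) (A : 'M[C]_(m, p)) (n : nat) :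
  A ^t* *m A = 1%:M -> (ntensmx A n) ^t* *m ntensmx A n = 1%:M.
Proof.
move=> AA; case: n => [|n].
  by rewrite ntensmx0 trmx1 map_mx1 mul1mx.
elim: n => [|n IH]; first by rewrite ntensmx1.
by rewrite ntensmxSS; exact: tensmx_isometry.
Qed.

(** With a variable width [m] the cast disappears by substitution, which the width [1 ^ n] of [ket0]
    would not permit. *)
Lemma braket_castmx (d m : nat) (B : 'M[C]_(d, m)) (m1 : m = 1%N) :
  B ^t* *m B = 1%:M ->
  braket (castmx (erefl d, m1) B) (castmx (erefl d, m1) B) = 1.
Proof. by subst m => BB; rewrite castmx_id /braket BB mxE. Qed.

Lemma braket_ket0 (n : nat) : braket (ket0 R n) (ket0 R n) = 1.
Proof.
apply/braket_castmx/ntensmx_isometry.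
rewrite trmx_delta map_delta_mx mul_delta_mx.
by apply/matrixP => i j; rewrite !mxE !ord1.
Qed.

End Ket0.

Lemma braket_gaussian_state (R : realType) (n : nat) (psi : 'cV[R[i]]_(2 ^ n)) :
  gaussian_state psi -> braket psi psi = 1.
Proof. by case=> U [UU _] ->; rewrite braket_unitary // braket_ket0. Qed.

(** * Norms and means of the circuit branches *)

Section CircuitBranches.
Variables (R : realType) (n T : nat) (E : adaptive_circuit R n T).
Local Notation C := R[i].
Local Open Scope complex_scope.
Local Open Scope sesquilinear_scope.
Local Notation operator := 'M[C]_(2 ^ n).
Implicit Types (G : 'I_T.+1 -> operator) (m : outcomes T) (s : seq 'I_T).

(** [branch] along an arbitrary list of times, for induction on the outermost gate. *)
Definition partial_branch G m s : operator :=
  foldl (fun A t => G (lift ord0 t) *m kraus E t (m t) *m A) (G ord0) s.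

Lemma partial_branch_rcons G m s t :
  partial_branch G m (rcons s t) =
  G (lift ord0 t) *m kraus E t (m t) *m partial_branch G m s.
Proof. by rewrite /partial_branch foldl_rcons. Qed.

Lemma eq_partial_branch G G' m m' s :
  G ord0 = G' ord0 -> {in s, forall t, G (lift ord0 t) = G' (lift ord0 t)} ->
  {in s, m =1 m'} -> partial_branch G m s = partial_branch G' m' s.
Proof.
move=> G0; elim/last_ind: s => [|s t IH] Gs ms //.
rewrite !partial_branch_rcons Gs ?ms ?mem_rcons ?mem_head // IH // => u us.
  by apply: Gs; rewrite mem_rcons inE us orbT.
by apply: ms; rewrite mem_rcons inE us orbT.
Qed.

(** Trace preservation applied to the rank-one operator of [x]. *)
Lemma kraus_norm t (x : 'cV[C]_(2 ^ n)) :
  \sum_b braket (kraus E t b *m x) (kraus E t b *m x) = braket x x.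
Proof.
rewrite -[RHS]mxtrace_outer -(@kraus_trace_preserving _ _ _ E t) /kraus_map raddf_sum.
by apply: eq_bigr => b _; rewrite /= mxtrace_conj_outer.
Qed.

(** Flipping outcome [t] is an involution. This isolates the sum over one outcome at the cost of
    counting everything twice. *)
Lemma sum_outcomes_flip (t : 'I_T) (F : outcomes T -> C) :
  (\sum_m F m) *+ 2 =
  \sum_(m : outcomes T) \sum_(b : bool) F [ffun u => if u == t then b else m u].
Proof.
pose flip m : outcomes T := [ffun u => if u == t then ~~ m t else m u].
have flipK : involutive flip.
  move=> m; apply/ffunP => u; rewrite !ffunE eqxx.
  by case: eqVneq => [->|_]; rewrite ?negbK.
rewrite mulr2n [X in _ + X](reindex_inj (inv_inj flipK)) -big_split.
apply: eq_bigr => m _; rewrite big_bool /=.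
have idE : m = [ffun u => if u == t then m t else m u].
  by apply/ffunP => u; rewrite ffunE; case: eqVneq => [->|].
by rewrite {1}idE /flip; case: (m t); rewrite // addrC.
Qed.

(* Summing over all outcomes counts each outcome on [s] [2 ^ (T - size s)]
   times, hence the powers of two. *)
Lemma partial_branch_norm G (x : 'cV[C]_(2 ^ n)) s :
  (forall t, G t \is unitarymx) -> uniq s ->
  (\sum_(m : outcomes T)
     braket (partial_branch G m s *m x) (partial_branch G m s *m x))
    *+ 2 ^ size s = braket x x *+ 2 ^ T.
Proof.
move=> GU; elim/last_ind: s => [_|s t IH].
  rewrite (eq_bigr (fun=> braket x x)); last first.
    by move=> m _; rewrite /partial_branch /= braket_unitary.
  by rewrite sumr_const card_ffun card_bool card_ord mulr1n.
rewrite rcons_uniq => /andP[ts us]; rewrite -(IH us) size_rcons expnS mulrnA.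
congr (_ *+ _); rewrite (sum_outcomes_flip t).
apply: eq_bigr => m _; rewrite -[RHS](kraus_norm t).
apply: eq_bigr => b _.
set m' := [ffun u => _].
have -> : partial_branch G m' (rcons s t) *m x =
    G (lift ord0 t) *m (kraus E t b *m (partial_branch G m s *m x)).
  rewrite partial_branch_rcons ffunE eqxx -2!mulmxA.
  rewrite (@eq_partial_branch G G m' m) // => u us'.
  by rewrite ffunE; case: eqVneq => // ut; rewrite -ut us' in ts.
by rewrite braket_unitary.
Qed.

(** Along all of ['I_T] both multiplicities equal [2 ^ T] and cancel. *)
Lemma branch_norm G (x : 'cV[C]_(2 ^ n)) :
  (forall t, G t \is unitarymx) ->
  \sum_(m : outcomes T) braket (branch E G m *m x) (branch E G m *m x) = braket x x.
Proof.
move=> GU; have := partial_branch_norm x GU (enum_uniq 'I_T).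
rewrite size_enum_ord -mulr_natl -[RHS]mulr_natl => /mulfI; apply.
by rewrite pnatr_eq0 expn_eq0.
Qed.

Lemma partial_branchZ (z : 'I_T.+1 -> C) G m s :
  partial_branch (fun t => z t *: G t) m s =
  (z ord0 * \prod_(t <- s) z (lift ord0 t)) *: partial_branch G m s.
Proof.
elim/last_ind: s => [|s t IH]; first by rewrite big_nil mulr1.
rewrite !partial_branch_rcons IH -!scalemxAl -scalemxAr scalerA.
by rewrite -cats1 big_cat big_seq1 /= mulrC mulrA.
Qed.

Lemma branchZ (z : 'I_T.+1 -> C) G m :
  branch E (fun t => z t *: G t) m = (\prod_t z t) *: branch E G m.
Proof. by rewrite [LHS]partial_branchZ big_ord_recl /= big_enum. Qed.

Section RandomGates.
Variables (V : 'I_T.+1 -> finType) (p : forall t, V t -> C).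
Variable F : forall t, V t -> operator.
Hypothesis p1 : forall t, \sum_a p (t := t) a = 1.
Local Notation mean t := (\sum_(a : V t) p a *: F a).

(** A branch is linear in each gate and the gates are independent, so the mean passes inside. The
    gates are resampled one by one; as [s] has no repetition, the earlier factors do not change. *)
Lemma mean_partial_branch m s : uniq s ->
  \sum_y point_weight p y *: partial_branch (fun t => F (y t)) m s =
  partial_branch (fun t => mean t) m s.
Proof.
elim/last_ind: s => [_|s t IH].
  rewrite (sum_resample _ (p1 ord0)).
  transitivity (\sum_y point_weight p y *: mean ord0).
    apply: eq_bigr => y _; congr (_ *: _); apply: eq_bigr => a _.
    by rewrite /partial_branch /= update_in.
  by rewrite -scaler_suml sum_prod_dffun big1 ?scale1r.
rewrite rcons_uniq => /andP[ts us].
rewrite (sum_resample _ (p1 (lift ord0 t))) partial_branch_rcons -(IH us).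
rewrite mulmx_sumr; apply: eq_bigr => y _; rewrite -scalemxAr; congr (_ *: _).
rewrite !mulmx_suml; apply: eq_bigr => a _.
rewrite partial_branch_rcons update_in -!scalemxAl; congr (_ *: (_ *m _)).
apply: eq_partial_branch => // [|u us']; rewrite update_out //.
by apply: contraNneq ts => /lift_inj <-.
Qed.

Lemma mean_branch m :
  \sum_y point_weight p y *: branch E (fun t => F (y t)) m =
  branch E (fun t => mean t) m.
Proof. exact: mean_partial_branch (enum_uniq _). Qed.

End RandomGates.

End CircuitBranches.

(** * The sampled vectors, their overlaps and [Ctilde] *)

Section SampledBranches.
Variables (R : realType) (n T : nat) (E : adaptive_circuit R n T).
Local Notation C := R[i].
Local Open Scope complex_scope.
Local Open Scope sesquilinear_scope.

Definition coeff_prob t (a : 'I_(nterms E t)) : R :=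
  cabs (coeff a) / coeff_norm1 E t.

Definition pattern_prob (v : pattern E) : R := point_weight coeff_prob v.

(** The sampled gate carries its share of [pcoeff_norm1 E], the product of all [coeff_norm1 E t], so
    that its mean is the gate itself. *)
Definition scaled_gate t (a : 'I_(nterms E t)) : 'M[C]_(2 ^ n) :=
  ((coeff_norm1 E t)%:C * (coeff a / `|coeff a|)) *: gterm a.

(** If the norm vanished, the gate would be 0, which is not unitary in dimension [2 ^ n > 0]. *)
Lemma coeff_norm1_gt0 t : 0 < coeff_norm1 E t.
Proof.
rewrite lt_neqAle sumr_ge0 => [|a _]; last exact: cabs_ge0.
rewrite andbT eq_sym; apply/eqP => /eqP.
rewrite psumr_eq0 => [/allP c0|a _]; last exact: cabs_ge0.
have gate0 : gate E t = 0.
  rewrite gate_decomposition big1 // => a _.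
  have := c0 a (mem_index_enum _); rewrite /= cabs_eq0 => /eqP ->.
  by rewrite scale0r.
have /unitarymxP := gate_unitary E t; rewrite gate0 mul0mx => /matrixP.
have i0 : 'I_(2 ^ n) by exists 0%N; rewrite expn_gt0.
by move=> /(_ i0 i0) /eqP; rewrite !mxE eqxx eq_sym oner_eq0.
Qed.

Lemma sum_coeff_prob t : \sum_a coeff_prob (t := t) a = 1.
Proof. by rewrite -mulr_suml divff // gt_eqF // coeff_norm1_gt0. Qed.

Lemma sum_pattern_prob : \sum_v pattern_prob v = 1.
Proof. by rewrite sum_prod_dffun big1 // => t _; rewrite sum_coeff_prob. Qed.

Lemma pattern_prob_ge0 v : 0 <= pattern_prob v.
Proof.
by apply: prodr_ge0 => t _; rewrite divr_ge0 ?cabs_ge0 // ltW // coeff_norm1_gt0.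
Qed.

Lemma pcoeff_norm1E : pcoeff_norm1 E = \prod_t coeff_norm1 E t.
Proof.
rewrite /pcoeff_norm1 -sum_prod_dffun.
by apply: eq_bigr => v _; rewrite cabs_prod.
Qed.

Lemma pcoeff_norm1_gt0 : 0 < pcoeff_norm1 E.
Proof. by rewrite pcoeff_norm1E prodr_gt0 // => t _; exact: coeff_norm1_gt0. Qed.

Lemma pattern_probE v : pattern_prob v = cabs (pcoeff v) / pcoeff_norm1 E.
Proof.
rewrite pcoeff_norm1E cabs_prod -prodfV -big_split.
exact: eq_bigr.
Qed.

Lemma mean_scaled_gate t :
  \sum_a (coeff_prob (t := t) a)%:C *: scaled_gate a = gate E t.
Proof.
rewrite gate_decomposition; apply: eq_bigr => a _.
rewrite scalerA; congr (_ *: _).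
have cN : (coeff_norm1 E t)%:C != 0 :> C.
  by rewrite fmorph_eq0 gt_eqF // coeff_norm1_gt0.
have aN : `|coeff a| != 0 by rewrite normr_eq0 coeff_neq0.
by rewrite /coeff_prob rmorphM fmorphV /= cabsE mulrA mulfVK // mulrC divfK.
Qed.

Variable phi0 : 'cV[C]_(2 ^ n).
Hypothesis phi0_norm : braket phi0 phi0 = 1.

(* The component at [m] of the vector [X_v]. *)
Definition scaled_out (v : pattern E) (m : outcomes T) : 'cV[C]_(2 ^ n) :=
  branch E (fun t => scaled_gate (v t)) m *m phi0.

(** The kernel of the U-statistic; the real part makes it symmetric. *)
Definition overlap (v w : pattern E) : R :=
  \sum_(m : outcomes T) complex.Re (braket (scaled_out v m) (scaled_out w m)).

Lemma mean_scaled_out m :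
  \sum_v (pattern_prob v)%:C *: scaled_out v m = psi_out E phi0 m.
Proof.
rewrite /psi_out (_ : gate E =
    fun t => \sum_a (coeff_prob (t := t) a)%:C *: scaled_gate a); last first.
  by apply/funext => t; rewrite mean_scaled_gate.
rewrite -mean_branch => [|t]; last first.
  by rewrite -rmorph_sum sum_coeff_prob.
rewrite mulmx_suml; apply: eq_bigr => v _.
by rewrite -scalemxAl /pattern_prob /point_weight rmorph_prod.
Qed.

Definition scaled_phase (v : pattern E) : C :=
  \prod_t ((coeff_norm1 E t)%:C * (coeff (v t) / `|coeff (v t)|)).

Lemma cabs_scaled_phase v : cabs (scaled_phase v) = pcoeff_norm1 E.
Proof.
rewrite cabs_prod pcoeff_norm1E; apply: eq_bigr => t _.
by rewrite cabsM cabs_sign ?coeff_neq0 // mulr1 cabs_real // ltW // coeff_norm1_gt0.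
Qed.

Lemma scaled_outE v m : scaled_out v m = scaled_phase v *: phi_out phi0 m v.
Proof. by rewrite /scaled_out branchZ -scalemxAl. Qed.

Lemma overlapC v w : overlap v w = overlap w v.
Proof.
by apply: eq_bigr => m _; exact: Re_braketC.
Qed.

(** Gaussian terms are unitary, so the unscaled vector has norm 1 and only the modulus of the phase
    factor remains. *)
Lemma overlap_diag v : overlap v v = pcoeff_norm1 E ^+ 2.
Proof.
rewrite /overlap -complex_Re_sum.
under eq_bigr => m _ do rewrite scaled_outE braketZr braketZl mulrA.
rewrite -mulr_sumr branch_norm ?phi0_norm => [|t]; last first.
  by have [] := gterm_gaussian (v t).
by rewrite mulr1 -sqr_normc -cabsE cabs_scaled_phase -rmorphXn.
Qed.

Lemma overlap_bound v w : overlap v w ^+ 2 <= pcoeff_norm1 E ^+ 4.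
Proof.
rewrite (exprM _ 2 2).
exact: sum_Re_braket_sqr_le (overlap_diag v) (overlap_diag w).
Qed.

Lemma mean_overlap v :
  \sum_w pattern_prob w * overlap v w =
  \sum_(m : outcomes T) complex.Re (braket (scaled_out v m) (psi_out E phi0 m)).
Proof.
under eq_bigr => w _ do rewrite mulr_sumr.
rewrite exchange_big; apply: eq_bigr => m _.
rewrite -mean_scaled_out braket_sumr complex_Re_sum.
by apply: eq_bigr => w _; rewrite braketZr complex_ReMl.
Qed.

Lemma mean_mean_overlap :
  \sum_v pattern_prob v * (\sum_w pattern_prob w * overlap v w) = 1.
Proof.
under eq_bigr => v _ do rewrite mean_overlap mulr_sumr.
rewrite exchange_big.
transitivity (complex.Re (\sum_(m : outcomes T)
    braket (psi_out E phi0 m) (psi_out E phi0 m))).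
  rewrite complex_Re_sum; apply: eq_bigr => m _.
  transitivity (complex.Re (braket (psi_out E phi0 m)
      (\sum_v (pattern_prob v)%:C *: scaled_out v m))); last first.
    by rewrite mean_scaled_out.
  rewrite braket_sumr complex_Re_sum; apply: eq_bigr => v _.
  by rewrite braketZr complex_ReMl; congr (_ * _); exact: Re_braketC.
by rewrite branch_norm ?phi0_norm //; exact: gate_unitary.
Qed.

(** Since [cabs (pcoeff v)] is [pcoeff_norm1 E * pattern_prob v], the square of [pcoeff_norm1 E] is
    left over and scales [phi_out] to [scaled_out]. *)
Lemma CtildeE : Ctilde E phi0 = \sum_v pattern_prob v *
  cabs (\sum_(m : outcomes T) braket (psi_out E phi0 m) (scaled_out v m)) ^+ 2.
Proof.
rewrite /Ctilde mulr_sumr; apply: eq_bigr => v _.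
under [in RHS]eq_bigr => m _ do rewrite scaled_outE braketZr.
rewrite -mulr_sumr cabsM cabs_scaled_phase pattern_probE.
by field; rewrite gt_eqF // pcoeff_norm1_gt0.
Qed.

(** The inner mean has mean 1, so the left side is its second moment minus 1; the squared real part
    is then bounded by the squared modulus. *)
Lemma mean_sqr_mean_overlap :
  \sum_v pattern_prob v * (\sum_w pattern_prob w * overlap v w - 1) ^+ 2 <=
  Ctilde E phi0 - 1.
Proof.
rewrite (eq_bigr (fun v =>
   pattern_prob v * (\sum_w pattern_prob w * overlap v w) ^+ 2
   - 2%:R * (pattern_prob v * (\sum_w pattern_prob w * overlap v w))
   + pattern_prob v)); last by move=> v _; ring.
rewrite !big_split /= sumrN -mulr_sumr mean_mean_overlap sum_pattern_prob.
rewrite mulr1 -addrA [- 2%:R + 1](_ : _ = - 1); last by ring.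
rewrite lerD2r CtildeE; apply: ler_sum => v _.
rewrite ler_wpM2l ?pattern_prob_ge0 // mean_overlap.
rewrite -cabsJ -complex_Re_sum.
apply: le_trans (complex_Re_sqr_le _) _; rewrite [X in _ <= cabs X ^+ 2]rmorph_sum.
by under [X in _ <= cabs X ^+ 2]eq_bigr => m _ do rewrite /= -braketC.
Qed.

(** The trace of each outcome term is a squared norm. Distributing [pcoeff_norm1 E] over the gates
    turns the vector into an average of [scaled_out]. *)
Lemma trOmega_pair_sum k (y : 'I_k -> pattern E) :
  trOmega phi0 (fun i t => y i t) =
  k%:R ^- 2 * \sum_i \sum_j overlap (y i) (y j).
Proof.
have out m : sparsified_kraus (fun i t => y i t) m *m phi0 =
    (k%:R^-1)%:C *: \sum_i scaled_out (y i) m.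
  rewrite /sparsified_kraus rmorphM /= mulrC -scalerA -scalemxAl; congr (_ *: _).
  rewrite scaler_sumr mulmx_suml; apply: eq_bigr => i _; congr (_ *m _).
  rewrite pcoeff_norm1E rmorph_prod -branchZ; congr branch.
  by apply/funext => t; rewrite scalerA.
rewrite /trOmega /Omega [\tr _]raddf_sum complex_Re_sum.
under eq_bigr => m _ do rewrite /= mxtrace_conj_outer out braketZl braketZr
  conjc_real !complex_ReMl braket_suml complex_Re_sum.
rewrite -!mulr_sumr mulrA -invfM -expr2; congr (_ * _).
rewrite exchange_big; apply: eq_bigr => i _.
under eq_bigr => m _ do rewrite braket_sumr complex_Re_sum.
by rewrite exchange_big.
Qed.

End SampledBranches.

(** * The variance bound *)

Lemma sampling_variance_le (R : realFieldType) (k : nat) (c x g2 h2 : R) :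
  (0 < k)%N -> g2 <= x - 1 -> h2 <= c ^+ 4 ->
  k%:R ^- 4 * (4%:R * k%:R * (k%:R - 1) * (k%:R - 2%:R) * g2
               + 2%:R * k%:R * (k%:R - 1) * (h2 - 1)) <=
  4 * (x - 1) / k%:R + 2 * (c ^+ 2 / k%:R) ^+ 2
  + (10 - 12 * x) / k%:R ^+ 2 + 8 * (x / k%:R ^+ 3).
Proof.
move=> k0 g2x h2c.
have K0 : 0 < k%:R :> R by rewrite ltr0n.
have K1 : 0 <= k%:R - 1 :> R by rewrite subr_ge0 ler1n.
(* For [k = 1] the second factor is negative, but the first is 0. *)
have K2 : 0 <= (k%:R - 1) * (k%:R - 2%:R) :> R.
  case: k k0 {K0 K1} => [//|[|k]] _; first by rewrite subrr mul0r.
  by rewrite mulr_ge0 // subr_ge0 ?ler1n // ler_nat.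
(* At [g2 = x - 1] and [h2 = c ^+ 4] the left side has exactly the stated terms of orders [1/k] and
   [1/k^2], and [8 x - 6 - 2 c^4] over [k^3]. This explains the constant 8 and the surplus
   [2 c^4 + 6]. *)
rewrite -subr_ge0 (_ : _ - _ = k%:R ^- 3 *
    (4%:R * ((k%:R - 1) * (k%:R - 2%:R)) * (x - 1 - g2)
     + 2%:R * (k%:R - 1) * (c ^+ 4 - h2) + 2%:R * (c ^+ 2) ^+ 2 + 6%:R)); last first.
  by field; rewrite gt_eqF.
apply: mulr_ge0; first by rewrite invr_ge0 exprn_ge0 // ltW.
have t1 : 0 <= 4%:R * ((k%:R - 1) * (k%:R - 2%:R)) * (x - 1 - g2).
  by apply: mulr_ge0; [exact: mulr_ge0 | rewrite subr_ge0].
have t2 : 0 <= 2%:R * (k%:R - 1) * (c ^+ 4 - h2).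
  by apply: mulr_ge0; [exact: mulr_ge0 | rewrite subr_ge0].
by have := sqr_ge0 (c ^+ 2); lra.
Qed.

Theorem lemma2 (R : realType) :
  exists M : R,
  forall (n T : nat) (E : adaptive_circuit R n T)
    (phi0 : 'cV[R[i]]_(2 ^ n)) (k : nat)
    (d : measure_display) (W : measurableType d) (P : probability W R)
    (v : 'I_k -> forall t : 'I_T.+1, W -> 'I_(nterms E t)),
  gaussian_state phi0 -> (0 < k)%N -> sampling_scheme P v ->
  ('V_P[fun w => trOmega phi0 (fun i t => v i t w)] <=
    (4 * (Ctilde E phi0 - 1) / k%:R
     + 2 * (pcoeff_norm1 E ^+ 2 / k%:R) ^+ 2
     + (10 - 12 * Ctilde E phi0) / k%:R ^+ 2
     + M * (Ctilde E phi0 / k%:R ^+ 3))%:E)%E.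
Proof.
exists 8 => n T E phi0 k d W P v /braket_gaussian_state phi0_norm k0 sv.
pose S (y : {dffun forall i : 'I_k, pattern E}) :=
  \sum_i \sum_j overlap phi0 (y i) (y j).
have -> : (fun w => trOmega phi0 (fun i t => v i t w)) =
    (fun w => k%:R ^- 2 * S (patterns_at v w)).
  apply/funext => w; rewrite /S -trOmega_pair_sum; congr trOmega.
  by apply/funext => i; apply/functional_extensionality_dep => t; rewrite !ffunE.
rewrite (variance_finite_rv (measurable_patterns_at sv)
  (probability_patterns_at sv) (fun y => k%:R ^- 2 * S y)).
rewrite lee_fin.
have mu1 : \sum_(a : pattern E) \sum_(b : pattern E)
    pattern_prob a * pattern_prob b * overlap phi0 a b = 1.
  rewrite -(mean_mean_overlap E phi0_norm); apply: eq_bigr => a _.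
  by rewrite mulr_sumr; apply: eq_bigr => b _; rewrite mulrA.
pose q := @pattern_prob R n T E.
have q1 : \sum_a q a = 1 := sum_pattern_prob E.
have meanS := sample_mean_pair_sum k q1 (overlapC phi0) (overlap_diag phi0_norm).
have varS := sample_variance_pair_sum k q1 (overlapC phi0) (overlap_diag phi0_norm).
rewrite -/q in mu1.
rewrite mu1 ?expr1n in meanS varS.
apply: le_trans (sampling_variance_le k0 (mean_sqr_mean_overlap E phi0_norm)
  (_ : \sum_a \sum_b q a * q b * overlap phi0 a b ^+ 2 <=
       pcoeff_norm1 E ^+ 4)); last first.
  rewrite -[leRHS]mul1r -q1 mulr_suml; apply: ler_sum => a _.
  rewrite -[leRHS]mul1r -q1 mulr_suml; apply: ler_sum => b _.
  rewrite [leRHS]mulrCA mulrA ler_wpM2l ?overlap_bound //.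
  by rewrite mulr_ge0 ?pattern_prob_ge0.
rewrite -varS.
(* The law of [patterns_at] is by conversion the product weight built from [q]. *)
change (sample_mean q (fun y => (k%:R ^- 2 * S y
  - sample_mean q (fun y' => k%:R ^- 2 * S y')) ^+ 2) <=
  k%:R ^- 4 * sample_mean q (fun y => (S y
  - (k%:R * (k%:R - 1) * 1 + k%:R * pcoeff_norm1 E ^+ 2)) ^+ 2)).
rewrite sample_meanZ meanS -sample_meanZ.
(* What remains is an equality: scaling by [k^-2] scales the variance by [k^-4]. *)
rewrite le_eqVlt; apply/orP; left; apply/eqP; apply: eq_sample_mean => y.
by rewrite -mulrBr exprMn -exprVn -exprM exprVn.
Qed.
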